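(* Let $N\ge1$ be an integer and $x\in\mathbb{C}$ with $\mathrm{Re}(x)>0$. Then, with infinite products understood as zeta-regularized products, $$\bar\Gamma_N(x)=\prod_{n=0}^\infty(n+x)^{(-1)^{n+1}\binom{n+N-1}{N-1}}.$$ In particular, $\bar\Gamma_1(x)=\prod_{n=0}^\infty(n+x)^{(-1)^{n+1}}$.
   Context: Powers use the principal branch. For $\mathrm{Re}(x)>0$, let $\zeta_{E,N}(s,x)=\sum_{m_1,\ldots,m_N=0}^\infty(-1)^{m_1+\cdots+m_N}(x+m_1+\cdots+m_N)^{-s}$ (absolutely convergent for $\mathrm{Re}(s)>N$), continued analytically in $s$ to a function holomorphic at $s=0$, and $\bar\Gamma_N(x)=\exp\left(\frac{\partial}{\partial s}\zeta_{E,N}(s,x)\big|_{s=0}\right)$. The zeta-regularized product $\prod_{n=0}^\infty(n+x)^{(-1)^{n+1}\binom{n+N-1}{N-1}}$ is by definition $\exp(G'(0))$, where $G$ is the analytic continuation to $s=0$ of the single series $G(s)=\sum_{n=0}^\infty(-1)^n\binom{n+N-1}{N-1}(n+x)^{-s}$ (convergent for $\mathrm{Re}(s)$ large). *)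

(* Defs.v *)
From HB Require Import structures.
From mathcomp Require Import all_boot all_order all_algebra complex.
From mathcomp Require Import all_classical all_reals all_analysis.
From mathcomp.analysis.showcase Require Export summability.
Set Implicit Arguments.
Unset Strict Implicit.
Unset Printing Implicit Defensive.
Import Order.TTheory GRing.Theory Num.Theory numFieldNormedType.Exports.
Local Open Scope classical_set_scope.
Local Open Scope complex_scope.
Local Open Scope ring_scope.

Section ComplexPower.
Variable R : realType.
Local Notation C := R[i].

Definition cexp (z : C) : C :=
  (expR (complex.Re z))%:C * (cos (complex.Im z) +i* sin (complex.Im z)).

(* principal argument, with values in ]-pi, pi] for z != 0 *)
Definition carg (z : C) : R :=
  let t := acos (complex.Re z / complex.Re `|z|) in
  if 0 <= complex.Im z then t else - t.

Definition clog (z : C) : C := ln (complex.Re `|z|) +i* carg z.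

Definition cpow (z s : C) : C := cexp (s * clog z).

End ComplexPower.

Section Continuation.
Variable R : realType.
(* R[i]^o is R[i] seen as a normed space over itself, so that [derivable F s 1]
   and [derive1] are complex differentiability and the complex derivative. *)
Local Notation C := (R[i]^o).

Definition half_plane (a : R) : set C := [set s | a < complex.Re s].

Definition holomorphic_on (U : set C) (F : C -> C) : Prop :=
  open U /\ forall s, U s -> derivable F s 1.

(* [S s l] reads "the series with parameter s converges, with sum l".  F is an
   analytic continuation to 0 of that sum when F is holomorphic on a domain
   that contains 0 and a right half-plane on which F is the sum. *)
Definition is_continuation_to0 (S : C -> C -> Prop) (F : C -> C) : Prop :=
  exists (a : R) (U : set C),
    [/\ connected U, U 0, half_plane a `<=` U, holomorphic_on U F &
        forall s, half_plane a s -> S s (F s)].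

(* By the identity theorem all continuations of the series used below agree
   near 0, so the continuation, its half-plane and its domain may be chosen
   freely without changing the derivative at 0. *)
Definition continuation_to0 (S : C -> C -> Prop) : C -> C :=
  xget (fun=> 0) [set F | is_continuation_to0 S F].

End Continuation.

Section MultipleGamma.
Variable R : realType.
Local Notation C := (R[i]^o).

(* Convergence along [totally], i.e. of the sums over finite sets of indices,
   is absolute convergence of the N-fold series. *)
Definition zetaE_sum (N : nat) (x s l : C) : Prop :=
  partial_sum (fun m : N.-tuple nat =>
    (-1) ^+ sumn m * cpow (x + (sumn m)%:R) (- s) : C) @ totally --> l.

Definition zetaE (N : nat) (x : C) : C -> C :=
  continuation_to0 (zetaE_sum N x).

Definition barGamma (N : nat) (x : C) : C := cexp (derive1 (zetaE N x) 0).

(* The zeta-regularized product of the a n with exponents w n is exp (G'(0)),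
   where G(s) continues the sum of the - w n * (a n) ^ (- s). *)
Definition zeta_reg_sum (a : nat -> C) (w : nat -> int) (s l : C) : Prop :=
  series (fun n => - (w n)%:~R * cpow (a n) (- s) : C) @ \oo --> l.

Definition zeta_reg_prod (a : nat -> C) (w : nat -> int) : C :=
  cexp (derive1 (continuation_to0 (zeta_reg_sum a w)) 0).

End MultipleGamma.

(* Main.v *)
Require Import Defs.
From HB Require Import structures.
From mathcomp Require Import all_boot all_order all_algebra complex.
From mathcomp Require Import all_classical all_reals all_analysis.
From mathcomp Require Import finmap ring lra.
Import Order.TTheory GRing.Theory Num.Theory numFieldNormedType.Exports.
Local Open Scope ring_scope.

(** Both sides are exponentials of the derivative at 0 of a continuation chosen
among all continuations of a series, so it suffices that the two series have
the same continuations.  A continuation only has to agree with its series on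
some right half-plane, which may be shrunk at will; hence two series with the
same sums on one common half-plane have exactly the same continuations
([continuation_to0_eq]), and no continuation has to be constructed.

It remains to compare, for [Re s >= N + 1], unconditional summation over
N-tuples with summation of the single series ([zetaE_sumP]).  The term at a
tuple [m] depends only on its degree [sumn m], and there are
['C(n + N - 1, N - 1)] tuples of degree [n] ([card_degree_shell]), so the
single series is the N-fold one grouped by degree.  Grouping is harmless in one
direction because the sets of tuples of degree less than [n] are cofinal among
finite sets ([cvg_series_shell]).  In the other direction the N-fold sum is
recovered from the grouped one because the norms are dominated, degree by
degree, by a convergent real series ([cvg_totally_shell]): the number of tuples
of degree [n] is at most [(n + 1) ^ (N - 1)], the terms decrease at least like
[(n + 1) ^ - (N + 1)] up to a constant factor ([norm_cpowN_le]), and the product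
[(n + 1) ^ - 2] of these two rates is at most twice the telescoping term
[1 / (n + 1) - 1 / (n + 2)]. *)

(** * Sums graded by degree *)

Section GradedSums.
Local Open Scope classical_set_scope.
Local Open Scope complex_scope.
Variables (I : choiceType) (g : I -> nat) (shell : nat -> {fset I}).
Hypothesis mem_shell : forall k i, (i \in shell k) = (g i == k).

Definition ball_upto n : {fset I} := (\bigcup_(k <- iota 0 n) shell k)%fset.

Lemma mem_ball_upto n i : (i \in ball_upto n) = (g i < n)%N.
Proof.
apply/bigfcupP/idP => [[k]|gi].
  by rewrite mem_iota add0n andbT mem_shell => /andP[_ kn] /eqP ->.
by exists (g i); rewrite ?mem_shell // mem_iota gi.
Qed.

Lemma sum_by_degree (V : zmodType) (F : I -> V) (s : seq I) n m : uniq s ->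
  (forall i, (i \in s) = (n <= g i < m)%N) ->
  \sum_(i <- s) F i = \sum_(n <= k < m) \sum_(i <- shell k) F i.
Proof.
move=> us ms.
transitivity (\sum_(i <- s) \sum_(n <= k < m | k == g i) F i).
  rewrite big_seq [RHS]big_seq; apply: eq_bigr => i; rewrite ms => gi.
  by rewrite big_nat1_eq gi.
rewrite (exchange_big_dep xpredT)//= big_nat [RHS]big_nat.
apply: eq_bigr => k nkm; rewrite -big_filter; apply: perm_big.
apply: uniq_perm => [||i]; rewrite ?filter_uniq ?fset_uniq //.
rewrite mem_filter ms mem_shell eq_sym.
by case: eqP => //= ->; rewrite nkm.
Qed.

Lemma fsubset_ball_upto (A : {fset I}) :
  exists n0, forall n, (n0 <= n)%N -> (A `<=` ball_upto n)%fset.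
Proof.
exists (\max_(i <- A) g i).+1 => n An; apply/fsubsetP => i iA.
rewrite mem_ball_upto (leq_trans _ An) // ltnS.
exact: leq_bigmax_seq.
Qed.

Lemma partial_sumE (V : zmodType) (f : I -> V) (A : {fset I}) :
  partial_sum f A = \sum_(i <- A) f i.
Proof. by rewrite /partial_sum big_seq_fsetE. Qed.

(** A finite set has bounded degree, so it lies in all large balls. *)
Lemma ball_upto_totally : ball_upto n @[n --> \oo] --> @totally I.
Proof.
move=> P [A _ AP]; have [n0 An0] := fsubset_ball_upto A.
exists n0 => // n /= n0n; apply: AP; exact: An0.
Qed.

Lemma partial_sum_ball_upto (V : zmodType) (f : I -> V) n :
  partial_sum f (ball_upto n) = series (fun k => \sum_(i <- shell k) f i) n.
Proof.
rewrite partial_sumE; apply: sum_by_degree => // i.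
exact: mem_ball_upto.
Qed.

(** The partial sums of the grouped series are the finite sums over the balls,
hence a subsequence of the net of all finite sums. *)
Lemma cvg_series_shell (K : numFieldType) (V : normedModType K) (f : I -> V)
    (l : V) :
  partial_sum f @ totally --> l ->
  series (fun k => \sum_(i <- shell k) f i) @ \oo --> l.
Proof.
move=> fl; have /funext <- := partial_sum_ball_upto V f.
exact: cvg_comp ball_upto_totally fl.
Qed.

(** Domination makes the grouped sum unconditional: a finite set [J] that
contains a large ball lies in a still larger one, and its sum differs from the
partial sum of the grouped series over that ball by at most a tail of [b].  The
candidate limit is given, so completeness is only used in the reals. *)
Lemma cvg_totally_shell (R : realType) (V : normedModType R[i]) (f : I -> V)
    (b : R^nat) (l : V) :
  (forall k, \sum_(i <- shell k) `|f i| <= (b k)%:C) -> cvgn (series b) ->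
  series (fun k => \sum_(i <- shell k) f i) @ \oo --> l ->
  partial_sum f @ totally --> l.
Proof.
have totF := @totally_filter I.
move=> fb /cauchy_cvgP/cauchy_seriesP cb /cvgrPdist_lt sl.
apply/cvgrPdist_lt => e e0.
(* [e] is a positive element of [R[i]], hence real, and [b] is real-valued. *)
have [r r0 er] : exists2 r : R, 0 < r & e / 2 = r%:C.
  have e20 : 0 < e / 2 by rewrite divr_gt0.
  exists (complex.Re (e / 2)); last by rewrite RRe_real // gtr0_real.
  by move: e20; rewrite ltcE => /andP[].
have [[P Q] /= [[n1 _ Pn1] [n2 _ Qn2]] PQ] := cb _ r0.
have [n3 _ Sn3] := sl (e / 2) ltac:(by rewrite divr_gt0).
pose n0 := maxn n1 n3.
exists (ball_upto n0) => // J /= n0J.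
have [m' Jm'] := fsubset_ball_upto J.
pose m := maxn m' (maxn n2 n3).
have Jm : (J `<=` ball_upto m)%fset by apply: Jm'; exact: leq_maxl.
rewrite -(subrKA (partial_sum f (ball_upto m))) [e]splitr.
rewrite (le_lt_trans (ler_normD _ _)) // ltrD //.
  by rewrite partial_sum_ball_upto; apply: Sn3; rewrite /= !leq_max leqnn !orbT.
rewrite !partial_sumE (bigID (mem J)) /=.
have -> : \sum_(i <- ball_upto m | i \in J) f i = \sum_(i <- J) f i.
  rewrite -big_filter; apply/perm_big/uniq_perm => // [|i].
    by rewrite filter_uniq.
  rewrite mem_filter; apply: andb_idr; exact/fsubsetP.
rewrite addrAC subrr add0r.
apply: (@le_lt_trans _ _ (\sum_(i <- ball_upto m | (n0 <= g i)%N) `|f i|)).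
  apply: le_trans (ler_norm_sum _ _ _) _.
  rewrite big_mkcond [leRHS]big_mkcond /=; apply: ler_sum => i _.
  case: ifPn => [iJ|_]; last by case: ifP.
  rewrite leqNgt ifT //; apply: contra iJ.
  by rewrite -mem_ball_upto; exact/fsubsetP.
rewrite -big_filter.
rewrite (@sum_by_degree _ _ _ n0 m) ?filter_uniq // => [|i]; last first.
  by rewrite mem_filter mem_ball_upto.
apply: le_lt_trans (ler_sum _ (fun k _ => fb k)) _.
rewrite er -rmorph_sum /= ltcR (le_lt_trans (ler_norm _)) //.
apply: (PQ (n0, m)); split; [apply: Pn1|apply: Qn2] => /=.
  by rewrite leq_max leqnn.
by rewrite !leq_max leqnn !orbT.
Qed.

End GradedSums.

(** * Tuples of given degree *)

(** The entries of a tuple of degree [n] are at most [n], so these tuples form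
the image of a finite set of tuples over ['I_n.+1], whose cardinal is known. *)
Definition degree_shell (N n : nat) : {fset N.-tuple nat} :=
  [fset map_tuple val t | t : N.-tuple 'I_n.+1 in
    [set t : N.-tuple 'I_n.+1 | (\sum_(i <- t) i == n)%N]]%fset.

Lemma mem_degree_shell N n (m : N.-tuple nat) :
  (m \in degree_shell N n) = (sumn m == n).
Proof.
apply/imfsetP/idP => [[t /=]|/eqP mn].
  rewrite inE => /eqP tn ->; apply/eqP.
  by rewrite -[RHS]tn sumnE /= big_map.
have mlt i : i \in tval m -> (i < n.+1)%N.
  move=> im; rewrite ltnS -mn sumnE.
  by rewrite (big_rem i) //= leq_addr.
exists (map_tuple inord m).
  rewrite /= inE big_map -[X in _ == X]mn sumnE big_seq [X in _ == X]big_seq.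
  by apply/eqP/eq_bigr => i /mlt /inordK.
apply/val_inj => /=; rewrite -map_comp -[LHS]map_id.
by apply/eq_in_map => i /mlt /inordK /= ->.
Qed.

Lemma card_degree_shell N n : #|` degree_shell N.+1 n| = 'C(n + N, N).
Proof.
rewrite card_imfset /=; last first.
  by move=> t u /(congr1 val)/(inj_map val_inj)/val_inj.
by rewrite -cardE addnC -card_ord_partitions.
Qed.

(** The binomial coefficient counts the N-tuples over ['I_n.+1] whose sum is at
most [n], and there are [n.+1 ^ N] tuples in all. *)
Lemma leq_bin_expn N n : ('C(n + N, N) <= n.+1 ^ N)%N.
Proof.
by rewrite addnC -card_partial_ord_partitions -[X in (_ <= X ^ _)%N]card_ord
  -card_tuple max_card.
Qed.

Lemma sum_degree_shell (V : zmodType) (N k : nat) (F : nat -> V) :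
  \sum_(m <- degree_shell N.+1 k) F (sumn m) = F k *+ 'C(k + N, N).
Proof.
rewrite -card_degree_shell big_seq (eq_bigr (fun=> F k)) => [|m].
  by rewrite -big_seq big_const_seq count_predT iter_addr_0.
by rewrite mem_degree_shell => /eqP ->.
Qed.

(** * Size of complex powers *)

Section Bounds.
Local Open Scope complex_scope.
Variable R : realType.

Lemma norm_Re_le (z : R[i]) : `|complex.Re z| <= complex.Re `|z|.
Proof. by rewrite -lecR RRe_real ?normr_real //; exact: normc_ge_Re. Qed.

Lemma norm_carg_le (z : R[i]) : `|carg z| <= pi.
Proof.
have h : -1 <= complex.Re z / complex.Re `|z| <= 1.
  have zr := norm_Re_le z; have r0 := le_trans (normr_ge0 _) zr.
  rewrite -ler_norml normrM normfV (ger0_norm r0).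
  have [->|n0] := eqVneq (complex.Re `|z|) 0; first by rewrite invr0 mulr0.
  by rewrite ler_pdivrMr ?mul1r // lt_def n0.
by rewrite /carg; case: ifP => _;
  rewrite ?normrN ger0_norm ?acos_lepi ?acos_ge0.
Qed.

Lemma norm_cexp (z : R[i]) : `|cexp z| = (expR (complex.Re z))%:C.
Proof.
rewrite /cexp normrM [X in _ * X]normc_def /= cos2Dsin2 sqrtr1 mulr1.
by rewrite ger0_norm // lecR expR_ge0.
Qed.

(** [Re (- s * clog z) = - Re s * ln |z| + Im s * carg z], where [|z| >= r] and
the argument is at most [pi] in absolute value. *)
Lemma norm_cpowN_le (z s : R[i]) (r : R) :
  0 < r <= complex.Re z -> 0 <= complex.Re s ->
  `|cpow z (- s)| <= (expR (`|complex.Im s| * pi) * r `^ (- complex.Re s))%:C.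
Proof.
move=> /andP[r0 rz] s0; rewrite /cpow norm_cexp lecR.
rewrite /powR gt_eqF // -expRD ler_expR.
have -> : complex.Re (- s * clog z) =
    complex.Im s * carg z + - complex.Re s * ln (complex.Re `|z|).
  by case: s {s0} => a b; rewrite /clog /=; simpc => /=; rewrite addrC.
rewrite lerD //.
  by rewrite (le_trans (ler_norm _)) // normrM ler_wpM2l // norm_carg_le.
rewrite !mulNr lerN2 ler_wpM2l // ler_ln ?posrE //.
  exact: le_trans rz (le_trans (ler_norm _) (norm_Re_le z)).
exact: lt_le_trans (lt_le_trans r0 rz) (le_trans (ler_norm _) (norm_Re_le z)).
Qed.

End Bounds.

(** * A dominating series *)

Section DominatingSeries.
Variable R : realType.

Lemma cvg_series_harmonic_sub (M : R) :
  cvgn (series (fun n => M * (harmonic n - harmonic n.+1))).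
Proof.
have -> : series (fun n => M * (harmonic n - harmonic n.+1)) =
    (fun n => M * (harmonic 0 - harmonic n)).
  apply/funext => n; elim: n => [|n ih]; first by
    rewrite /series /= big_geq // subrr mulr0.
  by rewrite seriesSr ih -mulrDr subrKA.
apply: is_cvgMr; apply: is_cvgB; first exact: is_cvg_cst.
by apply/cvg_ex; exists 0; exact: cvg_harmonic.
Qed.

(** The left side is at most [c `^ (- t) * (n + 1) ^ - 2]; the right side
telescopes when summed over [n]. *)
Lemma bin_powR_le (N n : nat) (c t : R) : 0 < c -> N.+2%:R <= t ->
  'C(n + N, N)%:R * (c * n.+1%:R) `^ (- t) <=
  2 * c `^ (- t) * (harmonic n - harmonic n.+1).
Proof.
move=> c0 Nt; rewrite powRM ?(ltW c0) // [leRHS]mulrAC mulrCA [leRHS]mulrC.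
rewrite ler_wpM2l ?powR_ge0 //.
have u0 : (0 : R) < n.+1%:R by [].
apply: (@le_trans _ _ (n.+1%:R ^+ N * (n.+1%:R ^+ N.+2)^-1)).
  rewrite ler_pM ?powR_ge0 // -?natrX ?ler_nat ?leq_bin_expn //.
  by rewrite natrX -powR_invn // ler_powR ?lerN2 // ler1n.
rewrite -[N.+2]addn2 exprD invfM mulrA divff ?expf_neq0 ?gt_eqF //.
rewrite mul1r /harmonic /=.
have u1 : (1 : R) <= n.+1%:R by rewrite ler1n.
rewrite -[n.+2%:R]natr1; move: u0 u1; set u := n.+1%:R => u0 u1.
have -> : 2 * (u^-1 - (u + 1)^-1) = 2 / (u * (u + 1)).
  by field; rewrite !gt_eqF // ltr_wpDr.
rewrite -[leLHS]mul1r ler_pdivlMr ?mulr_gt0 ?ltr_wpDr // mulrAC.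
rewrite ler_pdivrMr ?exprn_gt0 //.
by nra.
Qed.

(** With [a = Re x], this turns decay in [Re (x + n)] into decay in [n + 1]. *)
Lemma scaled_le_shift (a : R) n : 0 < a -> Num.min a 1 * n.+1%:R <= a + n%:R.
Proof.
move=> a0; rewrite -natr1 mulrDr mulr1 addrC lerD ?ge_min ?lexx //.
by rewrite ler_piMl // ge_min lexx orbT.
Qed.

End DominatingSeries.

(** * Comparison of the two series *)

Section Comparison.
Local Open Scope classical_set_scope.
Local Open Scope complex_scope.
Variable R : realType.

(** The term of the single series is the sum of the N-fold terms over one degree
shell, with multiplicity the cardinal of the shell.  The real part of [s]
exceeds the number [N.+1] of variables by one, so that the shells, of size
[O((n + 1) ^ N)], are dominated by [O((n + 1) ^ - 2)]. *)
Lemma zetaE_sumP (N : nat) (x s l : R[i]) : 0 < complex.Re x ->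
  N.+2%:R <= complex.Re s ->
  zetaE_sum N.+1 x s l <->
  zeta_reg_sum (fun n => n%:R + x)
    (fun n => (-1) ^+ n.+1 * 'C(n + N.+1 - 1, N.+1 - 1)%:Z) s l.
Proof.
move=> x0 sN; have s0 : 0 <= complex.Re s by apply: le_trans sN.
pose F k : R[i]^o := (-1) ^+ k * cpow (x + k%:R) (- s).
have sumE k : \sum_(m <- degree_shell N.+1 k) F (sumn m) =
    - ((-1) ^+ k.+1 * 'C(k + N.+1 - 1, N.+1 - 1)%:Z)%:~R *
      cpow (k%:R + x) (- s).
  rewrite sum_degree_shell addnS !subn1 /= /F rmorphM /= rmorphXn /= rmorphN1.
  by rewrite exprS !mulN1r !mulNr opprK [x + _]addrC mulrAC -pmulrn mulr_natr.
rewrite /zeta_reg_sum; have /funext <- := sumE.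
split; first by apply: cvg_series_shell => k i; exact: mem_degree_shell.
pose c := Num.min (complex.Re x) 1.
have c0 : 0 < c by rewrite lt_min x0 ltr01.
pose M := expR (`|complex.Im s| * pi) * (2 * c `^ (- complex.Re s)).
apply: (cvg_totally_shell _ _ _ _ _ _ _
  (fun n => M * (harmonic n - harmonic n.+1))).
- by move=> k i; exact: mem_degree_shell.
- move=> k; rewrite (sum_degree_shell _ N k (fun k => `|F k|)) /F normrM.
  rewrite normrX normrN1 expr1n mul1r.
  apply: (@le_trans _ _ ((expR (`|complex.Im s| * pi) *
      (c * k.+1%:R) `^ (- complex.Re s))%:C *+ 'C(k + N, N))).
    rewrite lerMn2r norm_cpowN_le ?orbT // mulr_gt0 //=.
    have -> : complex.Re (x + k%:R) = complex.Re x + k%:R.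
      by rewrite raddfD /= raddfMn.
    exact: scaled_le_shift.
  rewrite -rmorphMn /= lecR -mulr_natl mulrCA -!mulrA ler_wpM2l ?expR_ge0 //.
  by rewrite mulrA bin_powR_le.
- exact: cvg_series_harmonic_sub.
Qed.

(** Replacing the abscissa [a] of a continuation by [max a b] keeps its domain
and reaches the half-plane where the two series agree; so the two sets of
continuations are equal, and so are the elements chosen from them. *)
Lemma continuation_to0_eq (b : R) (S T : R[i]^o -> R[i]^o -> Prop) :
  (forall s l, b <= complex.Re s -> S s l <-> T s l) ->
  continuation_to0 S = continuation_to0 T.
Proof.
move=> ST; rewrite /continuation_to0; congr (xget _ _).
suff sub (S' T' : R[i]^o -> R[i]^o -> Prop) :
  (forall s l, b <= complex.Re s -> S' s l -> T' s l) ->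
  [set F | is_continuation_to0 S' F] `<=` [set F | is_continuation_to0 T' F].
  by apply/seteqP; split; apply: sub => s l bs /(ST s l bs).
move=> ST' F [a [U [cU U0 aU hF SF]]]; exists (Num.max a b), U.
have aab s : half_plane (Num.max a b) s -> half_plane a s /\ b <= complex.Re s.
  by rewrite /half_plane /= gt_max => /andP[-> /ltW].
split=> // s /aab[as_ bs]; first exact: aU.
by apply: ST' => //; exact: SF.
Qed.

Lemma barGamma_eq_zeta_reg_prod (b : R) N (x : R[i]) (a : nat -> R[i]^o)
    (w : nat -> int) :
  (forall s l, b <= complex.Re s ->
     zetaE_sum N x s l <-> zeta_reg_sum a w s l) ->
  barGamma N x = zeta_reg_prod a w.
Proof.
move=> /continuation_to0_eq E.
by rewrite /barGamma /zetaE E.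
Qed.

End Comparison.

Theorem proposition3p1 (R : realType) (N : nat) (x : R[i])
    (hN : (1 <= N)%N) (hx : 0 < complex.Re x) :
  barGamma N x =
    zeta_reg_prod (fun n => n%:R + x)
                  (fun n => (-1) ^+ n.+1 * 'C(n + N - 1, N - 1)%:Z)
  /\ barGamma 1 x = zeta_reg_prod (fun n => n%:R + x) (fun n => (-1) ^+ n.+1).
Proof.
have gammaE M : barGamma M.+1 x = zeta_reg_prod (fun n => n%:R + x)
    (fun n => (-1) ^+ n.+1 * 'C(n + M.+1 - 1, M.+1 - 1)%:Z).
  apply: (barGamma_eq_zeta_reg_prod _ M.+2%:R) => s l.
  exact: zetaE_sumP.
split; first by rewrite -(prednK hN); exact: gammaE.
rewrite gammaE; congr zeta_reg_prod; apply/funext => n.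
by rewrite subnn bin0 mulr1.
Qed.
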